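(* Let $n \in \mathbb{N}$ with $n \ge 1$ and let $B,\tilde{B} \in \{0,1\}^n$. Let $\tau$ denote the takum decoding function on $n$-bit strings. Then $$\tau(B) = \tau(\tilde{B}) \;\Rightarrow\; B = \tilde{B},$$ that is, $\tau$ is an injective function on $\{0,1\}^n$.
   Context: Takum encoding. Let $n \in \mathbb{N}$ with $n \ge 12$. An $n$-bit string, written from most significant bit (MSB) to least significant bit (LSB), is split as $(S,D,R,C,M) \in \{0,1\}^n$, where: - $S \in \{0,1\}$ is the sign bit (1 bit) and $D \in \{0,1\}$ is the direction bit (1 bit); - $R = (R_2,R_1,R_0) \in \{0,1\}^3$ are the regime bits, and the regime is $r := 7 - (4R_2 + 2R_1 + R_0)$ if $D=0$, and $r := 4R_2+2R_1+R_0$ if $D=1$, so $r \in \{0,\dots,7\}$; - $C = (C_{r-1},\dots,C_0) \in \{0,1\}^r$ are the characteristic bits, and the characteristic is $c := -2^{r+1}+1+\sum_{i=0}^{r-1} C_i 2^i$ if $D=0$, and $c := 2^r - 1 + \sum_{i=0}^{r-1} C_i 2^i$ if $D=1$; - $p := n-r-5 \in \{n-12,\dots,n-5\}$ is the mantissa bit count, $M = (M_{p-1},\dots,M_0) \in \{0,1\}^p$ are the mantissa bits, and $m := 2^{-p}\sum_{i=0}^{p-1} M_i 2^i \in [0,1)$ is the mantissa; - $\ell := (-1)^S (c+m)$ is the logarithmic value. The takum value is $\tau((S,D,R,C,M)) := 0$ if $S=0$ and all bits of $D,R,C,M$ are zero; $:= \mathrm{NaR}$ (''not a real'', a special non-real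 symbol) if $S=1$ and all bits of $D,R,C,M$ are zero; and $:= (-1)^S (\sqrt{\mathrm{e}})^{\ell}$ otherwise, where $\mathrm{e}$ is Euler's number. For $n < 12$, the value of a string is obtained by assuming the missing (least significant) bits to be zero (''ghost bits''), i.e. by appending zero bits on the LSB side until length 12. *)

(* Defs.v *)
From HB Require Import structures.
From mathcomp Require Import all_boot all_order all_algebra.
From mathcomp Require Import all_classical all_reals all_analysis.

Set Implicit Arguments.
Unset Strict Implicit.
Unset Printing Implicit Defensive.

Import Order.TTheory GRing.Theory Num.Theory.
Local Open Scope ring_scope.

(* Bit strings are sequences of booleans written from the most significant
   bit to the least significant one, i.e. [:: S, D, R_2, R_1, R_0 & C ++ M]
   with C = [:: C_(r-1); ...; C_0] and M = [:: M_(p-1); ...; M_0]. *)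

(* Bits are indexed from the least significant end: bit s i is the s_i in
   s = (s_(k-1), ..., s_0), where k = size s. *)
Definition bit (s : seq bool) (i : nat) : bool := nth false (rev s) i.

Definition bits_val (s : seq bool) : nat :=
  (\sum_(i < size s) bit s i * 2 ^ i)%N.

Inductive takum_value (R : Type) : Type :=
| NaR
| RealVal of R.
Arguments NaR {R}.

Section LongStrings.

(* The fields below are the intended ones only when 12 <= size s; then
   size s = 5 + r + p, with C of length r and M of length p. *)
Variable s : seq bool.

Definition sign_bit : bool := nth false s 0.
Definition direction_bit : bool := nth false s 1.
Definition regime_bits : seq bool := take 3 (drop 2 s).

Definition regime : nat :=
  if direction_bit then bits_val regime_bits
  else (7 - bits_val regime_bits)%N.

Definition characteristic_bits : seq bool := take regime (drop 5 s).

Definition characteristic : int :=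
  if direction_bit
  then 2 ^+ regime - 1 + (bits_val characteristic_bits)%:Z
  else - 2 ^+ regime.+1 + 1 + (bits_val characteristic_bits)%:Z.

Definition mantissa_bit_count : nat := (size s - regime - 5)%N.
Definition mantissa_bits : seq bool := drop (5 + regime) s.

Variable R : realType.

Definition mantissa : R :=
  2 ^- mantissa_bit_count * (bits_val mantissa_bits)%:R.

Definition logarithmic_value : R :=
  (-1) ^+ sign_bit * (characteristic%:~R + mantissa).

Definition takum_long : takum_value R :=
  if all negb (behead s) then (if sign_bit then NaR else RealVal 0)
  else RealVal ((-1) ^+ sign_bit * (Num.sqrt (expR 1) `^ logarithmic_value)).

End LongStrings.

(* Ghost bits: this is the identity on strings of length at least 12. *)
Definition ghost_extend (s : seq bool) : seq bool :=
  s ++ nseq (12 - size s) false.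

Definition takum (R : realType) (n : nat) (B : n.-tuple bool) : takum_value R :=
  takum_long (ghost_extend B) R.

(* Main.v *)
(* A nonzero real takum value determines the sign bit by its sign, and then c + m
   because sqrt e > 1.  As 0 <= m < 1, the characteristic c is the floor of c + m.
   The sign of c gives D, and 2^r <= c + 1 < 2^(r+1) (if D = 1) or
   2^r <= -c < 2^(r+1) (if D = 0) gives r; the remaining fields are then binary
   expansions of known lengths and values. *)
Require Import Defs.
From HB Require Import structures.
From mathcomp Require Import all_boot all_order all_algebra.
From mathcomp Require Import all_classical all_reals all_analysis.
From mathcomp Require Import zify lra.

Set Implicit Arguments.
Unset Strict Implicit.
Unset Printing Implicit Defensive.

Import Order.TTheory GRing.Theory Num.Theory.
Local Open Scope ring_scope.

(** [bit] counts from the end, so an appended bit becomes bit 0 and shifts the others up; this is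
    why the inductions below peel off the last bit. *)
Lemma bits_val_rcons (s : seq bool) (b : bool) :
  bits_val (rcons s b) = (b + (bits_val s).*2)%N.
Proof.
rewrite /bits_val size_rcons big_ord_recl /bit rev_rcons /= muln1.
congr addn; rewrite -mul2n big_distrr /=; apply: eq_bigr => i _.
by rewrite expnS mulnCA.
Qed.

Lemma bits_val_lt (s : seq bool) : (bits_val s < 2 ^ size s)%N.
Proof.
elim/last_ind: s => [|s b IHs]; first by rewrite /bits_val big_ord0.
by rewrite bits_val_rcons size_rcons expnS; case: b; lia.
Qed.

(** The last bit is the parity of the value and the other bits encode its half. Equal sizes rule out
    differing leading zeros. *)
Lemma bits_val_inj (s t : seq bool) :
  size s = size t -> bits_val s = bits_val t -> s = t.
Proof.
elim/last_ind: s t => [|s b IHs] t; first by case: t.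
case/lastP: t => [|t b']; rewrite ?size_rcons // => -[eq_sz].
rewrite !bits_val_rcons => eq_val.
have eq_b : b = b' by move: eq_val; case: (b); case: (b'); lia.
by rewrite eq_b (IHs t) //; move: eq_val; rewrite eq_b; lia.
Qed.

(** Chaining the bounds crosswise gives [i < j.+1] and [j < i.+1]. *)
Lemma expr2_bracket_inj (i j : nat) (x : int) :
  2 ^+ i <= x < 2 ^+ i.+1 -> 2 ^+ j <= x < 2 ^+ j.+1 -> i = j.
Proof.
move=> /andP[ix xi] /andP[jx xj]; apply/eqP; rewrite eqn_leq.
rewrite -(ltnS i) -(ltnS j) -!(@ltr_eXn2l int 2) //.
by rewrite (le_lt_trans ix xj) (le_lt_trans jx xi).
Qed.

Lemma size_regime_bits (s : seq bool) :
  (12 <= size s)%N -> size (regime_bits s) = 3.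
Proof. by move=> hs; rewrite size_take size_drop; case: ifP; lia. Qed.

Lemma regime_bits_le7 (s : seq bool) :
  (12 <= size s)%N -> (bits_val (regime_bits s) <= 7)%N.
Proof.
by move=> /size_regime_bits hs; have := bits_val_lt (regime_bits s); rewrite hs.
Qed.

Lemma regime_le7 (s : seq bool) : (12 <= size s)%N -> (regime s <= 7)%N.
Proof. by move=> /regime_bits_le7; rewrite /regime; case: ifP; lia. Qed.

Lemma size_characteristic_bits (s : seq bool) :
  (12 <= size s)%N -> size (characteristic_bits s) = regime s.
Proof.
move=> hs; have := regime_le7 hs.
by rewrite size_take size_drop; case: ifP; lia.
Qed.

Lemma size_mantissa_bits (s : seq bool) :
  size (mantissa_bits s) = mantissa_bit_count s.
Proof. by rewrite size_drop /mantissa_bit_count; lia. Qed.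

Lemma bitstring_split (s : seq bool) : (12 <= size s)%N ->
  s = [:: sign_bit s, direction_bit s
        & regime_bits s ++ characteristic_bits s ++ mantissa_bits s].
Proof.
move=> hs; rewrite /mantissa_bits addnC -drop_drop cat_take_drop.
rewrite (_ : 5 = 3 + 2)%N // -drop_drop cat_take_drop.
by case: s hs => [|a [|b s]] //= _; rewrite drop0.
Qed.

(** With v < 2^r the value of the characteristic bits, c + 1 = 2^r + v if D = 1, and -c = 2^(r+1) -
    1 - v if D = 0. *)
Lemma characteristic_bracket (s : seq bool) : (12 <= size s)%N ->
  2 ^+ regime s
    <= (if direction_bit s then characteristic s + 1 else - characteristic s)
    < 2 ^+ (regime s).+1.
Proof.
move=> hs; have := bits_val_lt (characteristic_bits s).
rewrite size_characteristic_bits // -(ltr_nat int) natrX natz /characteristic !exprS.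
by case: direction_bit; move: (2 ^+ _) => w; lia.
Qed.

Lemma characteristic_inj (s t : seq bool) :
  (12 <= size s)%N -> (12 <= size t)%N ->
  characteristic s = characteristic t ->
  [/\ direction_bit s = direction_bit t, regime_bits s = regime_bits t
    & characteristic_bits s = characteristic_bits t].
Proof.
move=> hs ht eq_c.
have bs := characteristic_bracket hs; have bt := characteristic_bracket ht.
have ps : 1 <= 2 ^+ regime s :> int by rewrite exprn_ege1.
have pt : 1 <= 2 ^+ regime t :> int by rewrite exprn_ege1.
(* As 2^r >= 1, the bracket forces c >= 0 when D = 1 and c <= -1 when D = 0. *)
have eq_d : direction_bit s = direction_bit t.
  by move: bs bt; rewrite -eq_c; do 2 case: direction_bit => //; lia.
have eq_r : regime s = regime t.
  by move: bs bt; rewrite -eq_c -eq_d; apply: expr2_bracket_inj.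
have rs := regime_bits_le7 hs; have rt := regime_bits_le7 ht.
split=> //; apply: bits_val_inj; rewrite ?size_regime_bits ?size_characteristic_bits //.
  (* For D = 0 the truncated subtraction from 7 is injective only because of the bounds [rs] and
     [rt]. *)
  by move: eq_r; rewrite /regime -eq_d; case: ifP => _; lia.
by move: eq_c; rewrite /characteristic -eq_d -eq_r; case: ifP => _; lia.
Qed.

Section Values.
Variable R : realType.

Lemma mantissa_itv (s : seq bool) : 0 <= mantissa s R < 1.
Proof.
rewrite /mantissa mulr_ge0 ?invr_ge0 ?exprn_ge0 //=.
rewrite mulrC ltr_pdivrMr ?exprn_gt0 // mul1r -natrX ltr_nat.
by rewrite -size_mantissa_bits bits_val_lt.
Qed.

Lemma floor_characteristic_mantissa (s : seq bool) :
  Num.floor ((characteristic s)%:~R + mantissa s R) = characteristic s.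
Proof.
by apply: floor_def; have := mantissa_itv s; rewrite intrD; lra.
Qed.

(** The sum c + m does not involve the sign bit, so only the tails can be recovered from it. *)
Lemma characteristic_mantissa_inj (s t : seq bool) :
  (12 <= size s)%N -> size s = size t ->
  (characteristic s)%:~R + mantissa s R = (characteristic t)%:~R + mantissa t R ->
  behead s = behead t.
Proof.
move=> hs eq_sz eq_cm; have ht : (12 <= size t)%N by rewrite -eq_sz.
have eq_c : characteristic s = characteristic t.
  by rewrite -floor_characteristic_mantissa eq_cm floor_characteristic_mantissa.
move: eq_cm; rewrite eq_c => /addrI.
have [eq_d eq_R eq_C] := characteristic_inj hs ht eq_c.
(* A common p makes the scale 2^-p cancel and gives the mantissa fields the same length. *)
have eq_p : mantissa_bit_count s = mantissa_bit_count t.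
  by rewrite /mantissa_bit_count /regime eq_sz eq_d eq_R.
rewrite /mantissa eq_p => /mulfI eq_m.
have eq_M : mantissa_bits s = mantissa_bits t.
  apply: bits_val_inj; first by rewrite !size_mantissa_bits.
  by apply/eqP; rewrite -(eqr_nat R) eq_m // invr_neq0 ?expf_neq0.
by rewrite (bitstring_split hs) (bitstring_split ht) /= eq_d eq_R eq_C eq_M.
Qed.

Lemma sqrt_expR1_gt1 : 1 < Num.sqrt (expR 1) :> R.
Proof. by rewrite -{1}sqrtr1 ltr_sqrt ?expR_gt0 // expR_gt1. Qed.

Lemma powR_sqrt_expR1_gt0 (x : R) : 0 < Num.sqrt (expR 1) `^ x.
Proof. by rewrite powR_gt0 // (lt_trans ltr01) ?sqrt_expR1_gt1. Qed.

(** Taking logarithms turns the power into multiplication by the nonzero factor ln(sqrt e). *)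
Lemma powR_sqrt_expR1_inj : injective (powR (Num.sqrt (expR 1 : R))).
Proof.
move=> x y /(congr1 (@ln R)); rewrite !ln_powR; apply: mulIf.
by rewrite gt_eqF // ln_gt0 // sqrt_expR1_gt1.
Qed.

Lemma takum_long_inj (s t : seq bool) :
  (12 <= size s)%N -> size s = size t ->
  takum_long s R = takum_long t R -> s = t.
Proof.
move=> hs eq_sz; have ht : (12 <= size t)%N by rewrite -eq_sz.
have eq_str : sign_bit s = sign_bit t -> behead s = behead t -> s = t.
  by rewrite /sign_bit; case: (s) hs => // a u _; case: (t) ht => // b v _ /= -> ->.
have signed_neq0 (b : bool) (x : R) :
    (-1) ^+ b * (Num.sqrt (expR 1) `^ x) != 0.
  by rewrite mulf_neq0 ?signr_eq0 // gt_eqF ?powR_sqrt_expR1_gt0.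
rewrite /takum_long.
case: (boolP (all negb (behead s))) => zs;
  case: (boolP (all negb (behead t))) => zt.
(* Both tails are zero: the value, [NaR] or 0, tells the sign bit. *)
- move=> eq_v; apply: eq_str; first by move: eq_v; case: (sign_bit s); case: (sign_bit t).
  have zeros (u : seq bool) : all negb u -> u = nseq (size u) false.
    by elim: u => //= -[] //= u IHu /IHu {1}->.
  by rewrite (zeros _ zs) (zeros _ zt) !size_behead eq_sz.
(* Only one tail is zero: [NaR] differs from any real by its constructor, and 0 from a signed power
   by [signed_neq0]. *)
- by case: sign_bit => // -[/esym/eqP]; rewrite (negPf (signed_neq0 _ _)).
- by case: (sign_bit t) => // -[/eqP]; rewrite (negPf (signed_neq0 _ _)).
move=> [eq_v]; have eq_s : sign_bit s = sign_bit t.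
  have := powR_sqrt_expR1_gt0 (logarithmic_value s R).
  have := powR_sqrt_expR1_gt0 (logarithmic_value t R).
  by move: eq_v; do 2 case: sign_bit => //=; rewrite ?expr0 ?expr1; lra.
apply: eq_str => //; apply: characteristic_mantissa_inj => //.
(* The common sign is cancelled twice: here in front of the power, then inside the exponent. *)
move: eq_v; rewrite eq_s => /mulfI; rewrite signr_eq0 => /(_ isT).
move=> /powR_sqrt_expR1_inj; rewrite /logarithmic_value eq_s => /mulfI.
by rewrite signr_eq0; apply.
Qed.

End Values.

Theorem proposition3 (R : realType) (n : nat) (hn : (1 <= n)%N)
    (B B' : n.-tuple bool) :
  takum R B = takum R B' -> B = B'.
Proof.
move=> /takum_long_inj; rewrite /ghost_extend !size_cat !size_nseq !size_tuple.
(* Truncated subtraction makes this length max(n, 12). *)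
have hlen : (12 <= n + (12 - n))%N by lia.
(* The prefixes have the same length n, so the ghost bits can be stripped. *)
move=> /(_ hlen erefl) /eqP; rewrite eqseq_cat ?size_tuple // => /andP[/eqP eqB _].
exact: val_inj.
Qed.
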